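(* For every simplicial complex $X$ and integer $i$ let $\Delta_i \colon C_\bullet(X;\mathbb{F}_2) \to C_\bullet(X;\mathbb{F}_2) \otimes C_\bullet(X;\mathbb{F}_2)$ be the linear map defined on an $n$-simplex $x \in X_n$ to be $0$ if $i \notin \{0,\dots,n\}$ and otherwise by $$\Delta_i(x) = \sum d_{U^0}(x) \otimes d_{U^1}(x),$$ where the sum is taken over all subsets $U = \{u_1 < \cdots < u_{n-i}\} \subseteq \{0,\dots,n\}$ of cardinality $n-i$, and $$U^0 = \{u_j \in U \mid u_j \equiv j \text{ mod } 2\}, \qquad U^1 = \{u_j \in U \mid u_j \not\equiv j \text{ mod } 2\}.$$ Then the maps $\Delta_i$ define a cup-$i$ construction. That is, the $\mathbb{F}_2[\mathbb{S}_2]$-linear maps $$\triangle_X \colon W \otimes C_\bullet(X;\mathbb{F}_2) \to C_\bullet(X;\mathbb{F}_2)^{\otimes 2}$$ determined by $\triangle_X(e_i \otimes c) = \Delta_i(c)$ for all $i \geq 0$ and $c \in C_\bullet(X;\mathbb{F}_2)$, for all simplicial complexes $X$, form a cup-$i$ construction.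
   Context: A simplicial complex is a pair consisting of a poset $V$ of vertices and a set $X$ of (finite) subsets of $V$, called simplices, such that the order of $V$ restricts to a total order on each element of $X$, every singleton $\{v\}$ with $v\in V$ is in $X$, and any subset of an element of $X$ is in $X$; it is denoted simply $X$. The set of $n$-simplices (those with $n+1$ vertices) is $X_n$, and an $n$-simplex is written $[v_0,\dots,v_n]$ with its vertices in increasing order. The face maps are $d_j([v_0,\dots,v_n]) = [v_0,\dots,\widehat{v}_j,\dots,v_n]$ for $0\le j\le n$. For $U = \{u_1<\dots<u_r\}\subseteq\{0,\dots,n\}$ and $x\in X_n$ write $d_U(x) = d_{u_1}\cdots d_{u_r}(x)$ (the face of $x$ obtained by deleting the vertices in positions $u_1,\dots,u_r$), with $d_\emptyset(x)=x$. $C_\bullet(X;\mathbb{F}_2)$ is the chain complex with $C_n(X;\mathbb{F}_2)$ the $\mathbb{F}_2$-vector space freely generated by $X_n$ for $n\ge 0$, $C_n = 0$ for $n<0$, and boundary $\partial x=\sum_{j=0}^n d_j(x)$ for $x \in X_n$. A simplicial map $f\colon X\to Y$ is a morphism (order-preserving map) of vertex posets sending simplices to simplices; its induced chain map $f_\bullet$ sends $[v_0,\dots,v_n]$ to $[f(v_0),\dots,f(v_n)]$ if the $f(v_j)$ are pairwise distinct and to $0$ otherwise. $\mathbb{S}_2$ is the group with only one non-identity element $T$. $W$ is the chain complex of free $\mathbb{F}_2[\mathbb{S}_2]$-modules with one generator $e_i$ in each degree $i\ge 0$ and boundary $\partial e_i = (1+T)e_{i-1}$ for $i\ge1$, $\partial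 e_0=0$. $\mathbb{S}_2$ acts on $W\otimes C_\bullet(X;\mathbb{F}_2)$ through the left factor and on $C_\bullet(X;\mathbb{F}_2)^{\otimes 2}$ by $T(a\otimes b)=b\otimes a$. Tensor products are over $\mathbb{F}_2$ with the usual boundary $\partial(a\otimes b)=\partial a\otimes b+a\otimes\partial b$. A (non-degenerate) cup-$i$ construction is a collection of $\mathbb{S}_2$-equivariant chain maps $\triangle_X\colon W\otimes C_\bullet(X;\mathbb{F}_2)\to C_\bullet(X;\mathbb{F}_2)^{\otimes 2}$, one for each simplicial complex $X$, which is natural, i.e. $\triangle_Y\circ(\mathrm{id}_W\otimes f_\bullet)=(f_\bullet\otimes f_\bullet)\circ\triangle_X$ for every simplicial map $f\colon X\to Y$, and such that $\triangle_X\neq0$ if $X$ is a simplicial complex with a single vertex. Equivalently, it is a collection $\{\triangle_i\}_{i\in\mathbb{Z}}$ of natural linear maps $C_\bullet\to C_\bullet^{\otimes2}$ (via $\triangle_i=\triangle(e_i\otimes -)$, with $\triangle_i = 0$ for $i<0$) satisfying $\triangle_0([v])\ne0$ for any vertex $v$ and $(1+T)\triangle_{i-1}=\partial\circ\triangle_i+\triangle_i\circ\partial$ for all $i\in\mathbb{Z}$. *)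

(* Defs.v *)
From HB Require Import structures.
From mathcomp Require Import all_boot all_order all_algebra.
From mathcomp Require Import finmap.
From mathcomp Require Import boolp.
From mathcomp.multinomials Require Import monalg.

Set Implicit Arguments.
Unset Strict Implicit.
Unset Printing Implicit Defensive.

Import Order.TTheory GRing.Theory.

Local Open Scope ring_scope.

(** * Chain complexes of F_2-vector spaces with a homogeneous basis *)

(* [{malg 'F_2[B]}] is the F_2-vector space freely generated by [B];
   [linext f] is the linear extension of [f]. It is locked, like [tens] below,
   because failing conversions between unfolded chains may not terminate. *)
HB.lock Definition linext (B : choiceType) (M : lmodType 'F_2) (f : B -> M)
    (c : {malg 'F_2[B]}) : M :=
  \sum_(b <- msupp c) c@_b *: f b.

Lemma linextE (B : choiceType) (M : lmodType 'F_2) (f : B -> M)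
    (c : {malg 'F_2[B]}) :
  linext f c = \sum_(b <- msupp c) c@_b *: f b.
Proof. by rewrite linext.unlock. Qed.

Lemma linextEw (B : choiceType) (M : lmodType 'F_2) (f : B -> M)
    (c : {malg 'F_2[B]}) (A : {fset B}) :
  (msupp c `<=` A)%fset -> linext f c = \sum_(b <- A) c@_b *: f b.
Proof.
move=> sA; rewrite linextE (big_fset_incl _ sA) // => b _ hb.
by rewrite mcoeff_outdom // scale0r.
Qed.

Lemma linext_is_linear (B : choiceType) (M : lmodType 'F_2) (f : B -> M) :
  linear (linext f).
Proof.
move=> a u v; pose A := (msupp u `|` msupp v)%fset.
have su : (msupp u `<=` A)%fset by exact: fsubsetUl.
have sv : (msupp v `<=` A)%fset by exact: fsubsetUr.
have s : (msupp (a *: u + v) `<=` A)%fset.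
  by apply: fsubset_trans (msuppD_le _ _) _; apply: fsetSU; exact: msuppZ_le.
rewrite (linextEw f su) (linextEw f sv) (linextEw f s) scaler_sumr -big_split.
by apply: eq_bigr => b _ /=; rewrite mcoeffD mcoeffZ scalerDl scalerA.
Qed.

HB.instance Definition _ (B : choiceType) (M : lmodType 'F_2) (f : B -> M) :=
  GRing.isLinear.Build 'F_2 {malg 'F_2[B]} M _ (linext f)
    (linext_is_linear f).

Lemma msupp_gen (B : choiceType) (b : B) :
  msupp (<< b >> : {malg 'F_2[B]}) = [fset b]%fset.
Proof. by rewrite msuppU oner_eq0. Qed.

Lemma linextU (B : choiceType) (M : lmodType 'F_2) (f : B -> M) (b : B) :
  linext f << b >> = f b.
Proof. by rewrite linextE msupp_gen big_seq_fset1 mcoeffUU scale1r. Qed.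

Lemma linear_eq (B : choiceType) (M : lmodType 'F_2)
    (g h : {malg 'F_2[B]} -> M) :
  linear g -> linear h -> (forall b, g << b >> = h << b >>) -> g =1 h.
Proof.
have ext (k : {malg 'F_2[B]} -> M) : linear k ->
    forall c, k c = linext (fun b => k << b >>) c.
  move=> kl c; pose K := GRing.isLinear.Build _ _ _ _ k kl.
  pose L : {linear _ -> _} := HB.pack k K.
  rewrite -[k]/(L : _ -> _) {1}(monalgE c) linear_sum linextE.
  apply: eq_bigr => b _; rewrite -linearZ /=; congr k; apply/malgP => x.
  by rewrite mcoeffZ !mcoeffU mulrnAr mulr1.
move=> gl hl e c; rewrite (ext g) // (ext h) //.
by rewrite !linextE; apply: eq_bigr => b _; rewrite e.
Qed.

(* Non-negatively graded: the component of degree [n] is the span of the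
   generators of degree [n], so all components of negative degree vanish. *)
Record complex := Complex {
  gens : choiceType;
  gdeg : gens -> nat;
  gbd : gens -> {malg 'F_2[gens]};
  gbd_deg : forall b b', b' \in msupp (gbd b) -> gdeg b = (gdeg b').+1;
  gbd_gbd : forall b, linext gbd (gbd b) = 0
}.

Definition chains (C : complex) := {malg 'F_2[gens C]}.
HB.instance Definition _ (C : complex) := GRing.Lmodule.on (chains C).

Definition bd (C : complex) : {linear chains C -> chains C} :=
  linext (@gbd C).

Definition homogeneous (C : complex) (n : nat) (c : chains C) : Prop :=
  forall b : gens C, b \in msupp c -> gdeg b = n.

Definition chain_map (C D : complex) (f : chains C -> chains D) : Prop :=
  [/\ linear f,
      forall n c, homogeneous n c -> homogeneous n (f c)
    & forall c, f (bd C c) = bd D (f c)].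

(** * Tensor products *)

(* The tensor product of the free vector spaces on [A] and [B] is realised as
   the free vector space on [A * B]; see [tens_universal]. *)
HB.lock Definition tens (A B : choiceType)
    (a : {malg 'F_2[A]}) (b : {malg 'F_2[B]}) : {malg 'F_2[(A * B)%type]} :=
  linext (fun x => linext (fun y => << (x, y) >>) b) a.

Notation "a ⊗ b" := (tens a b) (at level 40, left associativity) : ring_scope.

Lemma tens_linearl (A B : choiceType) (b : {malg 'F_2[B]}) :
  linear (fun a : {malg 'F_2[A]} => a ⊗ b).
Proof. by move=> k u v; rewrite tens.unlock linearP. Qed.

Lemma tens_linearr (A B : choiceType) (a : {malg 'F_2[A]}) :
  linear (fun b : {malg 'F_2[B]} => a ⊗ b).
Proof.
move=> k u v; rewrite tens.unlock ![linext _ a]linextE scaler_sumr -big_split.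
by apply: eq_bigr => x _ /=; rewrite linearP scalerDr !scalerA [k * _]mulrC.
Qed.

HB.instance Definition _ (A B : choiceType) (a : {malg 'F_2[A]}) :=
  GRing.isLinear.Build 'F_2 {malg 'F_2[B]} {malg 'F_2[(A * B)%type]} _ (tens a)
    (tens_linearr a).

Lemma tensUU (A B : choiceType) (x : A) (y : B) :
  << x >> ⊗ << y >> = << (x, y) >>.
Proof. by rewrite tens.unlock !linextU. Qed.

Lemma tens_universal (A B : choiceType) (M : lmodType 'F_2)
    (f : {malg 'F_2[A]} -> {malg 'F_2[B]} -> M) :
  (forall a, linear (f a)) -> (forall b, linear (fun a => f a b)) ->
  exists! g : {malg 'F_2[(A * B)%type]} -> M,
    linear g /\ forall a b, g (a ⊗ b) = f a b.
Proof.
move=> fr fl; pose G := linext (fun p : A * B => f << p.1 >> << p.2 >>).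
have Gl : linear G by exact: linext_is_linear.
exists G; split; last first.
  move=> h [hl hT]; apply/funext/linear_eq => // -[x y].
  by rewrite -tensUU hT tensUU /G linextU.
split=> // a b; move: a.
apply: (@linear_eq _ _ (fun a => G (a ⊗ b)) (fun a => f a b)) => //.
  by move=> k u v; rewrite tens_linearl Gl.
move=> x; move: b; apply: (@linear_eq _ _ (fun b => G (<< x >> ⊗ b))) => //.
  by move=> k u v; rewrite tens_linearr Gl.
by move=> y; rewrite tensUU /G linextU.
Qed.

Definition tens_map (A A' B B' : choiceType)
    (f : {malg 'F_2[A]} -> {malg 'F_2[A']})
    (g : {malg 'F_2[B]} -> {malg 'F_2[B']}) :
    {linear {malg 'F_2[(A * B)%type]} -> {malg 'F_2[(A' * B')%type]}} :=
  linext (fun p => f << p.1 >> ⊗ g << p.2 >>).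

Definition tens_gbd (C D : complex) (p : gens C * gens D) :
    {malg 'F_2[(gens C * gens D)%type]} :=
  gbd p.1 ⊗ << p.2 >> + << p.1 >> ⊗ gbd p.2.

Lemma msupp_tens (A B : choiceType) (a : {malg 'F_2[A]}) (b : {malg 'F_2[B]})
    (p : A * B) :
  p \in msupp (a ⊗ b) -> p.1 \in msupp a /\ p.2 \in msupp b.
Proof.
case: p => x y /=; rewrite -!mcoeff_neq0.
suff -> : (a ⊗ b)@_(x, y) = a@_x * b@_y.
  by rewrite mulf_eq0 negb_or => /andP[].
move: a; apply: (@linear_eq _ ('F_2)^o (fun a => (a ⊗ b)@_(x, y))
  (fun a => a@_x * b@_y)) => [k u v|k u v|u].
- by rewrite tens_linearl mcoeffD mcoeffZ.
- by rewrite mcoeffD mcoeffZ mulrDl -mulrA.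
move: b; apply: (@linear_eq _ ('F_2)^o (fun b => (<< u >> ⊗ b)@_(x, y))
  (fun b => << u >>@_x * b@_y)) => [k b c|k b c|v].
- by rewrite tens_linearr mcoeffD mcoeffZ.
- by rewrite mcoeffD mcoeffZ mulrDr mulrCA.
rewrite tensUU !mcoeffU xpair_eqE.
by case: (u == x); case: (v == y); rewrite /= ?mulr1n ?mulr0n ?mulr1 ?mulr0.
Qed.

Lemma tens_gbd_deg (C D : complex) (p p' : gens C * gens D) :
  p' \in msupp (tens_gbd p) ->
  (gdeg p.1 + gdeg p.2)%N = (gdeg p'.1 + gdeg p'.2).+1.
Proof.
case: p p' => [x y] [x' y'] /(fsubsetP (msuppD_le _ _)) /fsetUP[] /= /msupp_tens;
  rewrite /= msupp_gen !inE => -[].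
- by move=> /gbd_deg-> /eqP->; rewrite addSn.
- by move=> /eqP-> /gbd_deg->; rewrite addnS.
Qed.

Lemma addcc (M : lmodType 'F_2) (c : M) : c + c = 0.
Proof.
rewrite -mulr2n -scaler_nat.
have -> : 2%:R = 0 :> 'F_2 by exact: val_inj.
by rewrite scale0r.
Qed.

Lemma linext_tens_gbd (C D : complex) (a : {malg 'F_2[gens C]})
    (b : {malg 'F_2[gens D]}) :
  linext (@tens_gbd C D) (a ⊗ b)
  = linext (@gbd C) a ⊗ b + a ⊗ linext (@gbd D) b.
Proof.
have [] := @tens_universal (gens C) (gens D) {malg 'F_2[(gens C * gens D)%type]}
  (fun a b => linext (@gbd C) a ⊗ b + a ⊗ linext (@gbd D) b).
- move=> u k v w /=; rewrite !(linearP, tens_linearr) /= scalerDr.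
  by rewrite addrACA.
- move=> u k v w /=; rewrite linearP /= !tens_linearl scalerDr.
  by rewrite addrACA.
move=> g [[gl gT] _]; rewrite -gT; move: (a ⊗ b).
apply: linear_eq => //; first exact: linext_is_linear.
by move=> -[x y]; rewrite -tensUU gT tensUU !linextU.
Qed.

Lemma tens_gbd_gbd (C D : complex) (p : gens C * gens D) :
  linext (@tens_gbd C D) (tens_gbd p) = 0.
Proof.
have -> : tens_gbd p = gbd p.1 ⊗ << p.2 >> + << p.1 >> ⊗ gbd p.2 by [].
rewrite raddfD /=.
rewrite (linext_tens_gbd (gbd p.1)) (linext_tens_gbd << p.1 >>).
rewrite (gbd_gbd p.1) (gbd_gbd p.2) (linextU _ p.1) (linextU _ p.2).
have -> : (0 : {malg 'F_2[gens C]}) ⊗ << p.2 >> = 0.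
  by rewrite tens.unlock linear0.
by rewrite linear0 add0r addr0 addcc.
Qed.

Definition tens_complex (C D : complex) : complex :=
  @Complex _ (fun p => gdeg p.1 + gdeg p.2)%N (@tens_gbd C D)
    (@tens_gbd_deg C D) (@tens_gbd_gbd C D).

(* The transposition T(a ⊗ b) = b ⊗ a. *)
Definition swap (B : choiceType) :
    {linear {malg 'F_2[(B * B)%type]} -> {malg 'F_2[(B * B)%type]}} :=
  linext (fun p => << (p.2, p.1) >>).

(** * The complex W *)

(* The F_2-basis of W: [(i, false)] stands for e_i, [(i, true)] for T e_i. *)
Definition W_gbd (p : nat * bool) : {malg 'F_2[(nat * bool)%type]} :=
  if p.1 is i.+1 then << (i, p.2) >> + << (i, ~~ p.2) >> else 0.

Lemma W_gbd_deg (p p' : nat * bool) : p' \in msupp (W_gbd p) -> p.1 = p'.1.+1.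
Proof.
case: p p' => [[|i] b] [j b']; rewrite /W_gbd /= ?msupp0 ?inE //.
move=> /(fsubsetP (msuppD_le _ _)) /fsetUP[]; rewrite msupp_gen inE;
  by case/eqP=> ->.
Qed.

Lemma W_gbd_gbd (p : nat * bool) : linext W_gbd (W_gbd p) = 0.
Proof.
case: p => [[|i] b]; rewrite {2}/W_gbd /= ?linear0 // linearD /= !linextU.
case: i => [|i]; rewrite /W_gbd /= ?addr0 // negbK.
by rewrite [X in _ + X]addrC addcc.
Qed.

Definition W : complex :=
  @Complex (nat * bool)%type fst W_gbd W_gbd_deg W_gbd_gbd.

Definition We (i : nat) : chains W := << (i, false) >>.

Definition WT : {linear chains W -> chains W} :=
  linext (fun p : gens W => << (p.1, ~~ p.2) >>).

(** * Simplicial complexes and their chains *)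

Record scomplex := SComplex {
  sdisp : Order.disp_t;
  vert : porderType sdisp;
  is_face : {fset vert} -> Prop;
  face_total : forall s, is_face s ->
    {in s &, forall u v : vert, (u <= v)%O || (v <= u)%O};
  face_vert : forall v : vert, is_face [fset v]%fset;
  face_sub : forall s t, is_face s -> (t `<=` s)%fset -> is_face t
}.

(* [v_0,...,v_n] with n >= 0: a non-empty member of the complex, given by the
   list of its vertices in increasing order; see [simplex_of_face]. *)
Definition is_simplex (X : scomplex) (s : seq (vert X)) : bool :=
  [&& s != [::], sorted <%O s & `[< is_face [fset v in s]%fset >]].

Record simplex (X : scomplex) := Simplex {
  vertices :> seq (vert X);
  verticesP : is_simplex vertices
}.
HB.instance Definition _ (X : scomplex) := [isSub for @vertices X].
HB.instance Definition _ (X : scomplex) := [Choice of simplex X by <:].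

Lemma simplex_of_face (X : scomplex) (s : {fset vert X}) :
  is_face s -> s != fset0 ->
  exists! x : simplex X, [fset v in vertices x]%fset = s.
Proof.
move=> Xs s0; pose t := sort <=%O (enum_fset s).
have mt : t =i s by move=> v; rewrite mem_sort.
have ts : sorted <%O t.
  rewrite lt_sorted_uniq_le sort_uniq fset_uniq /=.
  by apply: (@sort_sorted_in _ (mem s)); [exact: face_total | apply/allP].
have et : [fset v in t]%fset = s by apply/fsetP => v; rewrite !inE mt.
have Pt : is_simplex t.
  rewrite /is_simplex ts et; apply/andP; split; last by apply/asboolP.
  by apply: contra s0 => /eqP t0; apply/eqP/fsetP=> v; rewrite -mt t0 !inE.
exists (Simplex Pt); split=> // y ey; apply: val_inj => /=.
have /and3P[_ ys _] := verticesP y.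
apply: (lt_sorted_eq ts ys) => v; rewrite mt -ey.
by rewrite !inE.
Qed.

Definition dim (X : scomplex) (x : simplex X) : nat := (size x).-1.

(* The chain [s_0,...,s_n]; it is 0 when [s] is not the vertex list of a
   simplex, which below concerns only [s = [::]], i.e. degree -1. *)
Definition simp (X : scomplex) (s : seq (vert X)) : {malg 'F_2[simplex X]} :=
  if insub s is Some x then << x >> else 0.

Definition del (T : Type) (j : nat) (s : seq T) : seq T :=
  take j s ++ drop j.+1 s.

Definition simp_gbd (X : scomplex) (x : simplex X) : {malg 'F_2[simplex X]} :=
  \sum_(j < (dim x).+1) simp (del j x).

Lemma size_del (T : Type) (j : nat) (s : seq T) :
  (j < size s)%N -> size (del j s) = (size s).-1.
Proof.
move=> js; rewrite size_cat size_take js size_drop.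
by rewrite subnS -subn1 addnBA ?subn_gt0 // subnKC ?subn1 // ltnW.
Qed.

Lemma del_subseq (T : eqType) (j : nat) (s : seq T) : subseq (del j s) s.
Proof.
rewrite -{2}(cat_take_drop j s) cat_subseq //.
by rewrite -addn1 addnC -drop_drop drop_subseq.
Qed.

Lemma del_del (T : Type) (j k : nat) (s : seq T) :
  (k <= j)%N -> (j.+1 < size s)%N -> del k (del j.+1 s) = del j (del k s).
Proof.
elim: s j k => // a s IHs [|j] [|k] //=; rewrite ?ltnS.
- by move=> _ _; rewrite /del /= !drop0.
- by move=> _ _; rewrite /del /= !drop0.
move=> kj js.
have delS i (r : seq T) b : del i.+1 (b :: r) = b :: del i r by [].
by rewrite !delS IHs.
Qed.

Lemma simplexS (X : scomplex) (x : simplex X) (s : seq (vert X)) :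
  subseq s x -> s != [::] -> is_simplex s.
Proof.
move=> sx s0; have /and3P[_ xs /asboolP Xx] := verticesP x.
rewrite /is_simplex s0 (subseq_sorted lt_trans sx xs); apply/asboolP.
by apply: face_sub Xx _; apply/fsubsetP => v; rewrite !inE; exact: mem_subseq.
Qed.

Lemma simpE (X : scomplex) (x : simplex X) : simp x = << x >>.
Proof. by rewrite /simp valK. Qed.

Lemma size_simplex (X : scomplex) (x : simplex X) : size x = (dim x).+1.
Proof.
by have /and3P[] := verticesP x; rewrite /dim -size_eq0; case: (size x).
Qed.

Lemma simp_gbd_deg (X : scomplex) (x y : simplex X) :
  y \in msupp (simp_gbd x) -> dim x = (dim y).+1.
Proof.
move=> yx; have [j jy] : exists j : 'I_(dim x).+1, y \in msupp (simp (del j x)).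
  apply: contrapT => h; move: yx; rewrite -mcoeff_neq0 /simp_gbd raddf_sum.
  rewrite big1 ?eqxx // => j _; apply/eqP; rewrite mcoeff_eq0.
  by apply/negP => jy; apply: h; exists j.
move: jy; rewrite /simp; case: insubP => [z _ zE|_]; last by rewrite msupp0 inE.
rewrite msupp_gen inE => /eqP ->.
by rewrite -size_simplex /= zE size_del ?size_simplex // ltn_ord.
Qed.

Lemma sum_del_del (M : lmodType 'F_2) (F : nat -> nat -> M) (n : nat) :
  (forall j k, (k <= j)%N -> (j < n)%N -> F j.+1 k = F k j) ->
  \sum_(j < n.+1) \sum_(k < n) F j k = 0.
Proof.
elim: n => [|n IHn] FE; first by rewrite big1 // => j _; rewrite big_ord0.
rewrite big_ord_recr /=.
under eq_bigr => j _ do rewrite big_ord_recr /=.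
rewrite big_split /= IHn => [|j k kj jn]; last by rewrite FE // ltnW.
rewrite add0r -big_split big1 // => k _ /=.
by rewrite FE -1?ltnS // addcc.
Qed.

Lemma simp_gbd_gbd (X : scomplex) (x : simplex X) :
  linext (@simp_gbd X) (simp_gbd x) = 0.
Proof.
rewrite {2}/simp_gbd linear_sum /=.
rewrite -[RHS](@sum_del_del _ (fun j k => simp (del k (del j x))) (dim x));
  last first.
  by move=> j k kj jd; rewrite del_del // size_simplex ltnS.
apply: eq_bigr => j _.
have sz : size (del j x) = dim x by rewrite size_del // size_simplex ltn_ord.
have [d0|d0] := eqVneq (del j x) [::].
  rewrite {1}/simp insubF ?d0 // linear0; move: sz; rewrite d0 /= => <-.
  by rewrite big_ord0.
have := simplexS (del_subseq j x) d0 => ps.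
rewrite {1}/simp insubT linextU /simp_gbd.
have -> : (dim (Sub (del j x) ps : simplex X)).+1 = dim x.
  by rewrite -size_simplex /= sz.
by [].
Qed.

(* C(X; F_2) *)
Definition schains (X : scomplex) : complex :=
  @Complex (simplex X) (@dim X) (@simp_gbd X) (@simp_gbd_deg X)
    (@simp_gbd_gbd X).

Record smap (X Y : scomplex) := SMap {
  smap_fun :> vert X -> vert Y;
  smap_homo : {homo smap_fun : u v / (u <= v)%O};
  smap_face : forall s, is_face s -> is_face [fset smap_fun v | v in s]%fset
}.

Definition smap_chain (X Y : scomplex) (f : smap X Y) :
    {linear chains (schains X) -> chains (schains Y)} :=
  linext (fun x : simplex X =>
    if uniq (map f x) then simp (map f x) else 0).

(** * Cup-i constructions *)

Definition cup_family : Type :=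
  forall X : scomplex,
    {linear chains (tens_complex W (schains X)) ->
            chains (tens_complex (schains X) (schains X))}.

(* S_2-equivariance; with F_2-linearity, this is F_2[S_2]-linearity. *)
Definition equivariant (D : cup_family) : Prop :=
  forall X w, D X (tens_map WT id w) = swap _ (D X w).

Definition natural (D : cup_family) : Prop :=
  forall (X Y : scomplex) (f : smap X Y) w,
    D Y (tens_map id (smap_chain f) w)
    = tens_map (smap_chain f) (smap_chain f) (D X w).

Definition cup_i_construction (D : cup_family) : Prop :=
  [/\ forall X, chain_map (D X),
      equivariant D,
      natural D
    & forall X : scomplex, (exists v : vert X, forall u, u = v) ->
        exists w, D X w != 0].

(** * The maps Delta_i *)

(* d_U = d_{u_1} ... d_{u_r} for U = {u_1 < ... < u_r}; [enum U] lists [U]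
   increasingly. *)
Definition dface (X : scomplex) (x : simplex X) (U : {set 'I_(dim x).+1}) :
    {malg 'F_2[simplex X]} :=
  simp (foldr (@del _) (vertices x) [seq val u | u <- enum U]).

(* The j such that u = u_j, for u in U = {u_1 < ... < u_r}. *)
Definition position (n : nat) (U : {set 'I_n}) (u : 'I_n) : nat :=
  #|[set v in U | (v <= u)%N]|.

Definition even_part (n : nat) (U : {set 'I_n}) : {set 'I_n} :=
  [set u in U | u == position U u %[mod 2]].

Definition odd_part (n : nat) (U : {set 'I_n}) : {set 'I_n} :=
  [set u in U | u != position U u %[mod 2]].

Definition Delta (X : scomplex) (i : int) :
    {linear chains (schains X) ->
            chains (tens_complex (schains X) (schains X))} :=
  linext (fun x : simplex X =>
    if 0 <= i <= (dim x)%:Z then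
      \sum_(U : {set 'I_(dim x).+1} | #|U|%:Z == (dim x)%:Z - i)
        dface (even_part U) ⊗ dface (odd_part U)
    else 0).

(* The maps W ⊗ C -> C ⊗ C are F_2[S_2]-linear and send e_i ⊗ c to
   Delta_i(c). *)
Definition determined_by_Delta (D : cup_family) : Prop :=
  equivariant D /\
  forall X (i : nat) (c : chains (schains X)), D X (We i ⊗ c) = Delta X i c.

(* Main.v *)
Require Import Defs.
From HB Require Import structures.
From mathcomp Require Import all_boot all_order all_algebra.
From mathcomp Require Import finmap boolp zify.
From mathcomp.multinomials Require Import monalg.

(** Write [U^c = {w_0 < ... < w_i}] for the complement of a set [U] of deleted
    positions.  The number of elements of [U^c] below [u = u_j] is [u - j + 1],
    so the parity condition on [u_j] says whether [u] lies after an odd or an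
    even number of the [w]'s.  Hence [Delta_i x] sums over all ways of choosing
    [i + 1] cut vertices in the vertex list of [x]: the cut vertices go to both
    tensor factors, and the blocks that they separate go alternately to the left
    and to the right factor, the first one to the left.  This description is
    recursive in the vertex list ([cuts]): reading one vertex more, it either
    joins the current block or is a cut vertex, after which the current side is
    the other one.  [sum_sets_cuts] identifies the two descriptions.

    Let [D b k s] be the sum over the ways to choose [k] cuts in [s] when the
    first block goes to the side [b].  For [s = v :: s'] it is
    [P_b (D b k s') + LR (D (~~ b) (k - 1) s')], where [P_b] pushes [v] on the
    side [b] and [LR] on both sides.  As the boundary satisfies [bd P_b = id + P_b bd] and
    [bd LR = P_true + P_false + LR bd], an induction on [s] gives
      [bd (D b k s) = D b k (bd s) + D b (k - 1) s + D (~~ b) (k - 1) s]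
    ([cutsum_bd]).  This computation takes place in the augmented complex, where
    the empty list is a generator of degree -1; there no case distinction for
    empty faces arises.  Passing to simplices kills the empty list, and since
    [D (~~ b)] is the transpose of [D b], the identity with [b = false] and
    [k = i + 1] becomes
      [bd (Delta_i x) = Delta_i (bd x) + (1 + T) Delta_(i - 1) x],
    where the last term vanishes for [i = 0], because cutting nowhere leaves one
    factor empty.

    Naturality is clear from the recursive description if the map is injective
    on the vertices of [x].  Otherwise, by monotonicity, it sends two consecutive
    vertices to the same one.  In each summand of [Delta_i x], some factor contains
    both of them: two consecutive vertices lie in the same block, or one of them
    is a cut vertex and is therefore in both factors ([cuts_repeat]).  So
    each summand is mapped to [0], as is [x].

    As [e_i] and [T e_i] form a basis of [W], equivariance and the values on the
    [e_i ⊗ c] leave no choice for the maps on [W ⊗ C]; [cup] is defined on this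
    basis. *)

Set Implicit Arguments.
Unset Strict Implicit.
Unset Printing Implicit Defensive.

Import Order.TTheory GRing.Theory.

Local Open Scope ring_scope.

(** * Cutting a list into blocks that alternate between two sides *)

Section Cuts.
Variable T : Type.
Implicit Types (v : T) (s : seq T) (p : seq T * seq T) (b : bool) (k : nat).

(** The side [true] is the right one. *)
Definition push b v p := if b then (p.1, v :: p.2) else (v :: p.1, p.2).

Definition push2 v p := (v :: p.1, v :: p.2).

(** The argument [k] counts the cut vertices still to be chosen, and [b] is the
    side that receives the current block. *)
Fixpoint cuts b k s : seq (seq T * seq T) :=
  if s is v :: s' then
    map (push b v) (cuts b k s')
    ++ (if k is k'.+1 then map (push2 v) (cuts (~~ b) k' s') else [::])
  else if k is 0 then [:: ([::], [::])] else [::].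

Lemma cuts_cons b k v s :
  cuts b k (v :: s) = map (push b v) (cuts b k s)
    ++ (if k is k'.+1 then map (push2 v) (cuts (~~ b) k' s) else [::]).
Proof. by []. Qed.

Lemma cuts_swap b k s :
  cuts (~~ b) k s = [seq (p.2, p.1) | p <- cuts b k s].
Proof.
elim: s b k => [|v s IHs] b [|k] //;
  rewrite !cuts_cons !IHs ?cats0 ?map_cat -!map_comp.
  by apply: eq_map => p /=; rewrite /push /=; case: b.
by congr (_ ++ _); rewrite -?map_comp; apply: eq_map => -[q r] //=; case: b.
Qed.

Lemma cuts_oversize b k s : (size s < k)%N -> cuts b k s = [::].
Proof.
elim: s b k => [|v s IHs] b [|k] //= sk.
by rewrite !IHs // ltnW.
Qed.

Lemma cuts0 b s : cuts b 0 s = [:: if b then ([::], s) else (s, [::])].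
Proof. by elim: s b => [|v s IHs] [] //; rewrite cuts_cons IHs. Qed.

(** The boundary of the generator [s] of the augmented complex, followed by the
    linear extension of [F]. Working with all [F] at once keeps chains of lists,
    and the pushing operators on them, out of the computation. *)
Definition bdsum (M : nmodType) (F : seq T -> M) s : M :=
  \sum_(j < size s) F (del j s).

Lemma bdsum_nil (M : nmodType) (F : seq T -> M) : bdsum F [::] = 0.
Proof. by rewrite /bdsum big_ord0. Qed.

Lemma bdsum_cons (M : nmodType) (F : seq T -> M) v s :
  bdsum F (v :: s) = F s + bdsum (fun r => F (v :: r)) s.
Proof. by rewrite /bdsum big_ord_recl /del /= drop0. Qed.

Definition cutsum (M : nmodType) (F : seq T -> seq T -> M) b k s : M :=
  \sum_(p <- cuts b k s) F p.1 p.2.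

Lemma cutsum_cons (M : nmodType) (F : seq T -> seq T -> M) b k v s :
  cutsum F b k (v :: s)
  = cutsum (fun q r => let p := push b v (q, r) in F p.1 p.2) b k s
    + (if k is k'.+1 then cutsum (fun q r => F (v :: q) (v :: r)) (~~ b) k' s
       else 0).
Proof.
rewrite /cutsum cuts_cons big_cat big_map /=; congr (_ + _).
by case: k => [|k]; rewrite ?big_nil ?big_map.
Qed.

Lemma cutsumD (M : nmodType) (F G : seq T -> seq T -> M) b k s :
  cutsum (fun q r => F q r + G q r) b k s = cutsum F b k s + cutsum G b k s.
Proof. by rewrite /cutsum big_split. Qed.

Lemma eq_cutsum (M : nmodType) (F G : seq T -> seq T -> M) b k s :
  (forall q r, F q r = G q r) -> cutsum F b k s = cutsum G b k s.
Proof. by move=> FG; rewrite /cutsum; apply: eq_bigr => p _; exact: FG. Qed.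

Lemma bdsumD (M : nmodType) (F G : seq T -> M) s :
  bdsum (fun r => F r + G r) s = bdsum F s + bdsum G s.
Proof. by rewrite /bdsum big_split. Qed.

(** The boundary of the tensor product, evaluated through [F]. *)
Definition bd2sum (M : nmodType) (F : seq T -> seq T -> M) q r : M :=
  bdsum (F^~ r) q + bdsum (F q) r.

Lemma cutsum_bd0 (M : lmodType 'F_2) (F : seq T -> seq T -> M) b s :
  cutsum (bd2sum F) b 0 s = bdsum (cutsum F b 0) s.
Proof.
rewrite /cutsum cuts0 big_seq1 /bd2sum.
case: b; rewrite /= bdsum_nil ?add0r ?addr0; apply: eq_bigr => j _;
  by rewrite cuts0 big_seq1.
Qed.

(** Let [v] be the first vertex. Where it is a cut vertex, deleting it from one
    factor leaves it in the other, so the boundary contributes [v] pushed on the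
    side [b], and [v] pushed on the side [~~ b], of the [k] cuts of the remaining
    list that start on the side [~~ b]. The first sum cancels a term that the
    induction hypothesis produces under the push of [v] on the side [b]; the
    second is the non-cut half of the last sum in the conclusion. *)
Lemma cutsum_bd (M : lmodType 'F_2) (F : seq T -> seq T -> M) b k s :
  cutsum (bd2sum F) b k.+1 s
  = bdsum (cutsum F b k.+1) s + cutsum F b k s + cutsum F (~~ b) k s.
Proof.
elim: s b k F => [|v s IHs] b k F.
  rewrite bdsum_nil /cutsum /= big_nil add0r; case: k => [|k] /=;
  by rewrite ?big_nil ?addr0 // !big_seq1 addcc.
(* [F] after pushing [v] on the side [c], and on both sides. *)
pose Fp c q r := let p := push c v (q, r) in F p.1 p.2.
pose F2 q r := F (v :: q) (v :: r).
rewrite cutsum_cons bdsum_cons.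
have -> : cutsum (fun q r => let p := push b v (q, r) in bd2sum F p.1 p.2)
    b k.+1 s = cutsum F b k.+1 s + cutsum (bd2sum (Fp b)) b k.+1 s.
  rewrite -cutsumD; apply: eq_cutsum => q r; rewrite /bd2sum /Fp.
  by case: b; rewrite /= bdsum_cons; [exact: addrCA | rewrite -addrA].
have -> : cutsum (fun q r => bd2sum F (v :: q) (v :: r)) (~~ b) k s
  = cutsum (Fp b) (~~ b) k s + cutsum (Fp (~~ b)) (~~ b) k s
    + cutsum (bd2sum F2) (~~ b) k s.
  rewrite -!cutsumD; apply: eq_cutsum => q r; rewrite /bd2sum /F2 /Fp.
  rewrite !bdsum_cons addrACA; congr (_ + _).
  by case: b; rewrite //= addrC.
have -> : bdsum (fun r => cutsum F b k.+1 (v :: r)) s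
  = bdsum (cutsum (Fp b) b k.+1) s + bdsum (cutsum F2 (~~ b) k) s.
  by rewrite -bdsumD; apply: eq_bigr => j _; rewrite cutsum_cons.
rewrite IHs 2!cutsum_cons -/(Fp b) -/(Fp (~~ b)) negbK.
case: k => [|k].
  rewrite cutsum_bd0 !addr0 -/F2.
  rewrite -!addrA; congr (_ + (_ + _)); rewrite [RHS]addrCA; congr (_ + _).
  by rewrite addrA addcc add0r addrC.
(* The two copies of [cutsum (Fp b) (~~ b) k.+1 s] cancel. *)
rewrite IHs negbK -/F2 -!addrA; congr (_ + (_ + _)).
rewrite [RHS]addrCA; congr (_ + _).
by rewrite addrA addcc add0r addrCA; congr (_ + _); rewrite addrCA.
Qed.

End Cuts.

Lemma cuts_map (T U : Type) (f : T -> U) b k (s : seq T) :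
  cuts b k (map f s) = [seq (map f p.1, map f p.2) | p <- cuts b k s].
Proof.
elim: s b k => [|v s IHs] b [|k] //; rewrite map_cons !cuts_cons !IHs ?map_cat;
  rewrite -!map_comp; congr (_ ++ _); apply: eq_map => p /=;
  by rewrite /push; case: b.
Qed.

Section CutsEq.
Variable T : eqType.
Implicit Types (v : T) (s : seq T) (p : seq T * seq T) (b : bool) (k : nat).

Lemma mem_cuts_cons b k v s p :
  p \in cuts b k (v :: s) ->
  (exists2 p', p' \in cuts b k s & p = push b v p')
  \/ (exists k' p', [/\ k = k'.+1, p' \in cuts (~~ b) k' s & p = push2 v p']).
Proof.
rewrite cuts_cons mem_cat => /orP[/mapP[p' ? ->]|]; first by left; exists p'.
case: k => // k /mapP[p' ? ->]; by right; exists k, p'.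
Qed.

Lemma cuts_subseq b k s p :
  p \in cuts b k s -> subseq p.1 s /\ subseq p.2 s.
Proof.
elim: s b k p => [|v s IHs] b k p; first by case: k => //= /[!inE] /eqP->.
case/mem_cuts_cons => [[q /IHs[q1 q2] ->]|[l [q [_ /IHs[q1 q2] ->]]]].
  rewrite /push; case: b; split=> //=; rewrite ?eqxx //;
  by apply: subseq_trans (subseq_cons _ _).
by split; rewrite /= eqxx.
Qed.

Lemma size_cuts b k s p :
  p \in cuts b k s -> (size p.1 + size p.2 = size s + k)%N.
Proof.
elim: s b k p => [|v s IHs] b k p; first by case: k => //= /[!inE] /eqP->.
case/mem_cuts_cons => [[q /IHs e ->]|[l [q [-> /IHs e ->]]]].
  by case: b; move: e => /=; lia.
by move=> /=; lia.
Qed.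

(** Two consecutive vertices always occur together in some factor: the side
    changes only at a cut vertex, and that vertex belongs to both factors. *)
Lemma cuts_repeat b k l v r p :
  p \in cuts b k (l ++ v :: v :: r) -> ~~ (uniq p.1 && uniq p.2).
Proof.
elim: l b k p => [|a l IHl] b k p.
  case/mem_cuts_cons => [[q]|[k' [q [_]]]];
  case/mem_cuts_cons => [[q' _ ->]|[k'' [q' [_ _ ->]]]] ->;
  by case: b; rewrite /= inE eqxx ?andbF.
case/mem_cuts_cons => [[q /IHl]|[k' [q [_ /IHl]]]];
  rewrite negb_and => h ->; rewrite negb_and.
  by case: b => /=; case/orP: h => /negPf ->; rewrite ?andbF ?orbT.
by case/orP: h => /= /negPf ->; rewrite andbF ?orbT.
Qed.

End CutsEq.

Lemma sorted_repeat d (V : porderType d) (s : seq V) :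
  sorted <=%O s -> ~~ uniq s -> exists l v r, s = l ++ v :: v :: r.
Proof.
elim: s => // a s IHs ss; rewrite [uniq _]/= negb_and negbK.
have [us|us _] := boolP (uniq s); last first.
  by have [l [v [r ->]]] := IHs (path_sorted ss) us; exists (a :: l), v, r.
rewrite orbF; case: s ss {IHs us} => // c s /= /andP[ac cs].
rewrite inE => /orP[/eqP<-|h]; first by exists [::], a, s.
have ca : (c <= a)%O.
  by have /allP := order_path_min le_trans cs; apply.
by exists [::], a, s; rewrite /= (le_anti (introT andP (conj ac ca))).
Qed.

(** * From sets of positions to cuts *)

(** The positions in [B] other than [0], shifted down by one: the induction on
    vertex lists removes the first vertex. *)
Definition tailset (n : nat) (B : {set 'I_n.+1}) : {set 'I_n} :=
  lift ord0 @^-1: B.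

Lemma val_enum_tailset n (B : {set 'I_n.+1}) :
  map val (enum B)
  = nseq (ord0 \in B) 0 ++ map succn (map val (enum (tailset B))).
Proof.
have enumE m (A : {set 'I_m}) : enum A = [seq u <- enum 'I_m | u \in A].
  by rewrite {1}/enum_mem -enumT.
rewrite (enumE _ B) (enumE _ (tailset B)) enum_ordSl /= filter_map.
rewrite (@eq_filter _ _ (mem (tailset B))) => [|u]; last by rewrite /= inE.
by case: (ord0 \in B); rewrite /= -!map_comp.
Qed.

Definition erase (T : Type) (n : nat) (s : seq T) (A : {set 'I_n}) : seq T :=
  foldr (@del T) s (map val (enum A)).

Lemma erase_cons (T : Type) n (v : T) s (B : {set 'I_n.+1}) :
  erase (v :: s) B
  = nseq (ord0 \notin B) v ++ erase s (tailset B).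
Proof.
have foldr_succ l :
    foldr (@del T) (v :: s) (map succn l) = v :: foldr (@del T) s l.
  by elim: l => //= j l ->.
rewrite /erase val_enum_tailset foldr_cat foldr_succ.
by case: (ord0 \in B); rewrite //= /del /= drop0.
Qed.

Lemma card_tailset n (B : {set 'I_n.+1}) :
  #|B| = ((ord0 \in B) + #|tailset B|)%N.
Proof.
rewrite (cardsD1 ord0); congr (_ + _)%N.
rewrite -[RHS](card_imset _ (@lift_inj _ ord0)); apply: eq_card => u.
case: (unliftP ord0 u) => [j|] ->; last first.
  rewrite !inE eqxx; apply/esym/negbTE/imsetP => -[j _ /eqP].
  by rewrite (negPf (neq_lift _ _)).
by rewrite (mem_imset _ _ (@lift_inj _ _)) !inE eq_sym (negPf (neq_lift _ _)).
Qed.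

Lemma position_lift n (B : {set 'I_n.+1}) (u : 'I_n) :
  position B (lift ord0 u) = ((ord0 \in B) + position (tailset B) u)%N.
Proof.
rewrite /position card_tailset !inE andbT; congr (_ + _)%N.
by apply: eq_card => v; rewrite !inE.
Qed.

(** The elements of [U] whose parity agrees with that of their position in [U]
    when [b] is [false], the others when [b] is [true]. Deleting the position
    [0] leaves this parity comparison unchanged when [0] is in [U], as both
    numbers drop by one, and reverses it otherwise: this is the change of side
    at a cut vertex. *)
Definition side (n : nat) (b : bool) (U : {set 'I_n}) : {set 'I_n} :=
  [set u in U | odd (u + position U u) == b].

Lemma even_partE n (U : {set 'I_n}) : even_part U = side false U.
Proof. by apply/setP => u; rewrite !inE; congr (_ && _); lia. Qed.

Lemma odd_partE n (U : {set 'I_n}) : odd_part U = side true U.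
Proof. by apply/setP => u; rewrite !inE; congr (_ && _); lia. Qed.

Lemma ord0_side n b (B : {set 'I_n.+1}) :
  (ord0 \in side b B) = (ord0 \in B) && b.
Proof.
rewrite inE; case: (boolP (ord0 \in B)) => //= B0.
suff -> : position B ord0 = 1 by case: b.
rewrite /position card_tailset !inE B0 [X in (_ + X)%N]eq_card0 // => v.
by rewrite !inE /= andbF.
Qed.

Lemma tailset_side n b (B : {set 'I_n.+1}) :
  tailset (side b B) = side (b (+) (ord0 \notin B)) (tailset B).
Proof.
apply/setP => u; rewrite !inE position_lift; congr (_ && _).
by rewrite lift0; case: (ord0 \in B); case: b; lia.
Qed.

Lemma erase_side_cons (T : Type) n (v : T) s b (B : {set 'I_n.+1}) :
  erase (v :: s) (side b B)
  = nseq (~~ ((ord0 \in B) && b)) v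
    ++ erase s (side (b (+) (ord0 \notin B)) (tailset B)).
Proof. by rewrite erase_cons ord0_side tailset_side. Qed.

Lemma sum_sets_ordS (M : nmodType) n (P : pred nat)
    (G : bool -> {set 'I_n} -> M) :
  \sum_(B : {set 'I_n.+1} | P #|B|) G (ord0 \in B) (tailset B)
  = \sum_(U : {set 'I_n} | P #|U|.+1) G true U
    + \sum_(U : {set 'I_n} | P #|U|) G false U.
Proof.
pose ext (c : bool) (U : {set 'I_n}) : {set 'I_n.+1} :=
  [set u | if unlift ord0 u is Some j then j \in U else c].
have ext0 c U : (ord0 \in ext c U) = c by rewrite inE unlift_none.
have extK c U : tailset (ext c U) = U.
  by apply/setP => u; rewrite !inE liftK.
have tailK (B : {set 'I_n.+1}) : ext (ord0 \in B) (tailset B) = B.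
  apply/setP => u; rewrite inE; case: unliftP => [j|] -> //.
  by rewrite inE.
rewrite (bigID (fun B : {set 'I_n.+1} => ord0 \in B)) /=; congr (_ + _).
  rewrite (reindex_onto (ext true) (@tailset n)) /=; last first.
    by move=> B /andP[_ B0]; rewrite -[RHS]tailK B0.
  apply: eq_big => [U|U _]; last by rewrite ext0 extK.
  by rewrite card_tailset ext0 extK eqxx !andbT.
rewrite (reindex_onto (ext false) (@tailset n)) /=; last first.
  by move=> B /andP[_ B0]; rewrite -[RHS]tailK (negPf B0).
apply: eq_big => [U|U _]; last by rewrite ext0 extK.
by rewrite card_tailset ext0 extK eqxx !andbT.
Qed.

(** The [k] cut vertices are the positions that [U] leaves out. *)
Lemma sum_sets_cuts (T : Type) (M : nmodType)
    (F : seq T -> seq T -> M) b k n (s : seq T) : size s = n ->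
  \sum_(U : {set 'I_n} | (#|U| + k == n)%N)
     F (erase s (side b U)) (erase s (side (~~ b) U))
  = cutsum F b k s.
Proof.
elim: s b k F n => [|v s IHs] b k F n /= <- {n}.
  have noU (A : {set 'I_0}) : A = set0 by apply/setP => -[].
  rewrite /cutsum; case: k => [|k] /=; last first.
    by rewrite big_nil big_pred0 // => U; rewrite (noU U) cards0.
  rewrite big_seq1 (big_pred1 set0) => [|U]; last first.
    by rewrite (noU U) cards0 /= eqxx.
  by rewrite !(noU (side _ _)) /erase enum_set0.
under eq_bigr => U _ do rewrite !erase_side_cons.
rewrite (sum_sets_ordS (fun c => (c + k == (size s).+1)%N)
  (fun c U => F (nseq (~~ (c && b)) v ++ erase s (side (b (+) ~~ c) U))
             (nseq (~~ (c && ~~ b)) v ++ erase s (side (~~ b (+) ~~ c) U)))).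
rewrite cutsum_cons; congr (_ + _) => /=.
  rewrite -(IHs _ _ _ _ erefl); apply: eq_bigr => U _.
  by rewrite !addbF; case: b.
case: k => [|k].
  rewrite big_pred0 // => U; rewrite addn0; apply/negbTE/eqP => e.
  by have := max_card (mem U); rewrite card_ord e ltnn.
rewrite -(IHs _ _ _ _ erefl); apply: eq_big => [U|U _]; first by rewrite addnS.
by rewrite !addbT negbK.
Qed.

(** * The maps Delta_i on simplices *)

Lemma tens_suml (A B : choiceType) (I : Type) (r : seq I)
    (F : I -> {malg 'F_2[A]}) (b : {malg 'F_2[B]}) :
  (\sum_(i <- r) F i) ⊗ b = \sum_(i <- r) F i ⊗ b.
Proof. by rewrite tens.unlock linear_sum. Qed.

Lemma tens0l (A B : choiceType) (b : {malg 'F_2[B]}) :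
  (0 : {malg 'F_2[A]}) ⊗ b = 0.
Proof. by rewrite tens.unlock linear0. Qed.

Lemma bd_gen (C : complex) (b : gens C) : bd C << b >> = gbd b.
Proof. exact: linextU. Qed.

Lemma bd_tens (C D : complex) (a : chains C) (b : chains D) :
  bd (tens_complex C D) (a ⊗ b) = bd C a ⊗ b + a ⊗ bd D b.
Proof. exact: linext_tens_gbd. Qed.

Lemma swap_gen (B : choiceType) (x y : B) : swap B << (x, y) >> = << (y, x) >>.
Proof. exact: linextU. Qed.

Section Simp.
Variable X : scomplex.
Implicit Types (x y : simplex X) (s q r : seq (vert X)).

Lemma simp_nil : simp ([::] : seq (vert X)) = 0.
Proof. by rewrite /simp insubF. Qed.

Lemma simp_gen s : is_simplex s ->
  exists2 y : simplex X, vertices y = s & simp s = << y >>.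
Proof. by move=> Ps; exists (Simplex Ps) => //; rewrite -simpE. Qed.

Lemma bd_simp x s : subseq s x -> bd (schains X) (simp s) = bdsum (@simp X) s.
Proof.
case: s => [|v s] sx; first by rewrite simp_nil linear0 bdsum_nil.
have [y ys ->] := simp_gen (simplexS sx isT).
by rewrite bd_gen /= /simp_gbd -size_simplex /bdsum ys.
Qed.

Definition simp2 q r : {malg 'F_2[(simplex X * simplex X)%type]} :=
  simp q ⊗ simp r.

Lemma bd_simp2 x q r : subseq q x -> subseq r x ->
  bd (tens_complex (schains X) (schains X)) (simp2 q r) = bd2sum simp2 q r.
Proof.
move=> qx rx; rewrite /simp2 bd_tens (bd_simp qx) (bd_simp rx) /bd2sum.
congr (_ + _).
  by rewrite /bdsum tens_suml.
by rewrite /bdsum linear_sum.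
Qed.

(** Outside the range [0 <= i <= dim x] no list of [dim x + 1] vertices has
    [i + 1] cut vertices, so no case distinction remains. *)
Lemma Delta_gen (i : nat) x :
  Delta X i << x >> = cutsum simp2 false i.+1 x.
Proof.
rewrite [LHS]linextU lez_nat /=; case: leqP => [ix|xi]; last first.
  by rewrite /cutsum cuts_oversize ?big_nil // size_simplex ltnS.
rewrite -(sum_sets_cuts _ _ _ (size_simplex x)); apply: eq_big => U.
  rewrite subzn // eqz_nat; move: ix #|U|; clear => ix m; lia.
by move=> _; rewrite even_partE odd_partE.
Qed.

Lemma Delta_simp (i : nat) x s : subseq s x ->
  Delta X i (simp s) = cutsum simp2 false i.+1 s.
Proof.
case: s => [|v s] sx; first by rewrite simp_nil linear0 /cutsum big_nil.
by have [y <- ->] := simp_gen (simplexS sx isT); rewrite Delta_gen.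
Qed.

Lemma swap_simp2 q r : swap _ (simp2 q r) = simp2 r q.
Proof.
rewrite /simp2 /simp; case: insubP => [x _ _|_]; case: insubP => [y _ _|_];
  by rewrite ?tens0l ?linear0 // ?tens0l ?linear0 // !tensUU swap_gen.
Qed.

Lemma swap_cutsum b k s :
  swap _ (cutsum simp2 b k s) = cutsum simp2 (~~ b) k s.
Proof.
rewrite /cutsum cuts_swap big_map linear_sum.
by apply: eq_bigr => p _; rewrite swap_simp2.
Qed.

(** For [i = 0] the last sums of [cutsum_bd] choose no cut vertex, so one of the
    two factors is empty and their images vanish. *)
Lemma bd_Delta (i : nat) x :
  bd (tens_complex (schains X) (schains X)) (Delta X i << x >>)
  = Delta X i (simp_gbd x)
    + (if i is i'.+1 then Delta X i' << x >> + swap _ (Delta X i' << x >>)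
       else 0).
Proof.
have cut_low : cutsum simp2 false i x + cutsum simp2 true i x
  = if i is i'.+1 then Delta X i' << x >> + swap _ (Delta X i' << x >>) else 0.
  case: i => [|i]; last by rewrite Delta_gen swap_cutsum.
  by rewrite /cutsum !cuts0 !big_seq1 /simp2 simp_nil tens0l linear0 addr0.
rewrite -cut_low Delta_gen addrA.
have -> : Delta X i (simp_gbd x) = bdsum (cutsum simp2 false i.+1) x.
  rewrite /simp_gbd -size_simplex linear_sum; apply: eq_bigr => j _.
  by rewrite (Delta_simp _ (del_subseq _ _)).
rewrite -[RHS](cutsum_bd _ false) /cutsum linear_sum.
apply: eq_big_seq => p /cuts_subseq[p1 p2]; exact: bd_simp2 p1 p2.
Qed.

End Simp.

(** * The cup-i construction *)

Lemma tensDl (A B : choiceType) (a a' : {malg 'F_2[A]}) (b : {malg 'F_2[B]}) :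
  (a + a') ⊗ b = a ⊗ b + a' ⊗ b.
Proof. by rewrite tens.unlock linearD. Qed.

Lemma tens_map_tens (A A' B B' : choiceType)
    (f : {linear {malg 'F_2[A]} -> {malg 'F_2[A']}})
    (g : {linear {malg 'F_2[B]} -> {malg 'F_2[B']}}) a b :
  tens_map f g (a ⊗ b) = f a ⊗ g b.
Proof.
move: a; apply: linear_eq => [k u v|k u v|x].
- by rewrite tens_linearl linearP.
- by rewrite linearP tens_linearl.
move: b; apply: linear_eq => [k u v|k u v|y].
- by rewrite tens_linearr linearP.
- by rewrite linearP tens_linearr.
by rewrite tensUU [LHS]linextU.
Qed.

Lemma swap_tens (A : choiceType) (a b : {malg 'F_2[A]}) :
  swap A (a ⊗ b) = b ⊗ a.
Proof.
move: a; apply: linear_eq => [k u v|k u v|x].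
- by rewrite tens_linearl linearP.
- by rewrite tens_linearr.
move: b; apply: linear_eq => [k u v|k u v|y].
- by rewrite tens_linearr linearP.
- by rewrite tens_linearl.
by rewrite !tensUU swap_gen.
Qed.

Lemma swapK (A : choiceType) : involutive (swap A).
Proof.
apply: linear_eq => [k u v|k u v|[x y]] //; first by rewrite !linearP.
by rewrite !swap_gen.
Qed.

Lemma bd_swap (C : complex) (c : chains (tens_complex C C)) :
  bd (tens_complex C C) (swap _ c) = swap _ (bd (tens_complex C C) c).
Proof.
move: c; apply: linear_eq => [k u v|k u v|[x y]]; try by rewrite !linearP.
rewrite swap_gen -!tensUU !bd_tens linearD /=.
by rewrite !swap_tens addrC.
Qed.

Lemma homogeneous0 (C : complex) n : homogeneous n (0 : chains C).
Proof. by move=> b; rewrite msupp0 inE. Qed.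

Lemma homogeneousD (C : complex) n (u v : chains C) :
  homogeneous n u -> homogeneous n v -> homogeneous n (u + v).
Proof.
by move=> hu hv b /(fsubsetP (msuppD_le _ _)) /fsetUP[/hu|/hv].
Qed.

Lemma homogeneous_linext (B : choiceType) (C : complex) n
    (f : B -> chains C) (c : {malg 'F_2[B]}) :
  (forall b, b \in msupp c -> homogeneous n (f b)) ->
  homogeneous n (linext f c : chains C).
Proof.
move=> hf; rewrite linextE big_seq.
apply: (big_ind (@homogeneous C n)) => [|u v|b /hf hb].
- exact: homogeneous0.
- exact: homogeneousD.
by move=> y /(fsubsetP (msuppZ_le _ _)); exact: hb.
Qed.

Section Family.
Variable X : scomplex.

Let CC := tens_complex (schains X) (schains X).

Definition twist (t : bool) (c : chains CC) : chains CC :=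
  if t then swap _ c else c.

Lemma twist_is_linear t : linear (twist t).
Proof. by case: t => // k u v; rewrite /twist linearP. Qed.

HB.instance Definition _ t :=
  GRing.isLinear.Build 'F_2 (chains CC) (chains CC) _ (twist t)
    (twist_is_linear t).

Lemma swap_twist t c : swap _ (twist t c) = twist (~~ t) c.
Proof. by case: t => //=; rewrite swapK. Qed.

Lemma bd_twist t c : bd CC (twist t c) = twist t (bd CC c).
Proof. by case: t => //; rewrite /twist bd_swap. Qed.

Definition cup : {linear chains (tens_complex W (schains X)) -> chains CC} :=
  linext (fun p : (nat * bool) * simplex X =>
    twist p.1.2 (Delta X p.1.1 << p.2 >>)).

Lemma cup_tens (i : nat) (t : bool) (c : chains (schains X)) :
  cup (<< (i, t) >> ⊗ c) = twist t (Delta X i c).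
Proof.
move: c; apply: linear_eq => [k u v|k u v|x].
- by rewrite tens_linearr linearP.
- by rewrite !linearP.
by rewrite tensUU [LHS]linextU.
Qed.

Lemma cup_equivariant w : cup (tens_map WT id w) = swap _ (cup w).
Proof.
move: w; apply: linear_eq => [k u v|k u v|[[i t] x]]; try by rewrite !linearP.
rewrite -tensUU (tens_map_tens WT idfun) cup_tens swap_twist -cup_tens.
by congr (cup (_ ⊗ _)); exact: linextU.
Qed.

Lemma cup_bd c :
  cup (bd (tens_complex W (schains X)) c) = bd CC (cup c).
Proof.
move: c; apply: linear_eq => [k u v|k u v|[[i t] x]]; try by rewrite !linearP.
rewrite -tensUU (bd_tens (C := W)) !bd_gen cup_tens bd_twist bd_Delta.
rewrite linearD /= linearD.
rewrite cup_tens addrC; congr (_ + _).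
case: i => [|i]; first by rewrite tens0l !linear0.
rewrite /W_gbd /= tensDl linearD /= !cup_tens linearD /=.
by case: t; rewrite /= ?swapK // addrC.
Qed.

(** Each cut vertex occurs in both factors and each other vertex in one, so the
    two factors have [dim x + 1 + (i + 1)] vertices, so their dimensions add up
    to [dim x + i]. *)
Lemma homogeneous_Delta (i : nat) (x : simplex X) :
  homogeneous (Defs.dim x + i) (Delta X i << x >> : chains CC).
Proof.
rewrite Delta_gen /cutsum big_seq.
apply: (big_ind (@homogeneous CC _)) => [|u v|p /size_cuts sp].
- exact: homogeneous0.
- exact: homogeneousD.
rewrite /simp2 => -[y z] /msupp_tens[/=].
rewrite /simp; case: insubP => [y' _ yp|_]; last by rewrite msupp0 inE.
case: insubP => [z' _ zp|_]; last by rewrite msupp0 inE.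
rewrite !msupp_gen !inE => /eqP-> /eqP->.
move: sp; rewrite -yp -zp !size_simplex /=; lia.
Qed.

Lemma homogeneous_swap n (c : chains CC) :
  homogeneous n c -> homogeneous n (swap _ c : chains CC).
Proof.
move=> hc; apply: homogeneous_linext => -[x y] /hc /= <- b.
by rewrite msupp_gen inE => /eqP-> /=; rewrite addnC.
Qed.

Lemma homogeneous_cup n c : homogeneous n c -> homogeneous n (cup c).
Proof.
move=> hc; apply: homogeneous_linext => -[[i t] x] /hc /= <-.
rewrite addnC; case: t; last exact: homogeneous_Delta.
by apply: homogeneous_swap; exact: homogeneous_Delta.
Qed.

Lemma cup_chain_map : chain_map cup.
Proof.
split; [by move=> k u v; rewrite linearP|exact: homogeneous_cup|exact: cup_bd].
Qed.

(** On a vertex, [Delta_0 [v] = [v] ⊗ [v]]. *)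
Lemma cup_neq0 : (exists v : vert X, forall u, u = v) -> exists w, cup w != 0.
Proof.
case=> v _.
have Pv : is_simplex [:: v].
  rewrite /is_simplex /=; apply/asboolP.
  have -> : [fset u in [:: v]]%fset = [fset v]%fset.
    by apply/fsetP => u; rewrite !inE orbF.
  exact: face_vert.
have [y yv _] := simp_gen Pv.
exists (<< (0%N, false) >> ⊗ << y >>).
rewrite cup_tens /twist Delta_gen yv /cutsum /= big_seq1 /= /simp2.
rewrite -yv simpE tensUU; apply/eqP => /(congr1 msupp).
by rewrite msupp_gen msupp0 => /fsetP/(_ (y, y)); rewrite !inE eqxx.
Qed.

End Family.

Section Naturality.
Variables (X Y : scomplex) (f : smap X Y).
Implicit Types (x : simplex X) (s : seq (vert X)).

Lemma sorted_smap x : sorted <=%O (map f x).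
Proof.
have /and3P[_ xs _] := verticesP x.
apply: (homo_sorted (e := <=%O)); first exact: smap_homo.
by rewrite lt_sorted_uniq_le in xs; case/andP: xs.
Qed.

Lemma smap_simplex x : uniq (map f x) -> is_simplex (map f x).
Proof.
move=> fx; have /and3P[x0 _ /asboolP Xx] := verticesP x.
apply/and3P; split; first by case: (vertices x) x0.
  by rewrite lt_sorted_uniq_le fx sorted_smap.
apply/asboolP; have := smap_face f Xx; congr is_face.
apply/fsetP => v; rewrite !inE /=; apply/imfsetP/mapP => -[u /= ux ->];
  by exists u => //; rewrite ?inE in ux *.
Qed.

Lemma smap_simp x s : subseq s x ->
  smap_chain f (simp s) = if uniq (map f s) then simp (map f s) else 0.
Proof.
case: s => [|v s] sx; first by rewrite !simp_nil linear0.
by have [y <- ->] := simp_gen (simplexS sx isT); rewrite [LHS]linextU.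
Qed.

(** A map that identifies two vertices of [x] identifies two consecutive ones,
    and then [cuts_repeat] makes each summand degenerate. *)
Lemma Delta_natural (i : nat) (c : chains (schains X)) :
  Delta Y i (smap_chain f c)
  = tens_map (smap_chain f) (smap_chain f) (Delta X i c).
Proof.
move: c; apply: linear_eq => [k u v|k u v|x]; try by rewrite !linearP.
have -> : tens_map (smap_chain f) (smap_chain f) (Delta X i << x >>)
  = \sum_(p <- cuts false i.+1 x)
      smap_chain f (simp p.1) ⊗ smap_chain f (simp p.2).
  rewrite Delta_gen /cutsum linear_sum; apply: eq_bigr => p _.
  by rewrite /simp2 tens_map_tens.
have -> : smap_chain f << x >> = if uniq (map f x) then simp (map f x) else 0.
  by rewrite -simpE (smap_simp (x := x)) // subseq_refl.
case: ifP => [fx|/negbT fx].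
  have [y yx ->] := simp_gen (smap_simplex fx).
  rewrite Delta_gen yx /cutsum cuts_map big_map.
  apply: eq_big_seq => p /cuts_subseq[p1 p2].
  rewrite /simp2 (smap_simp p1) (smap_simp p2) /=.
  by rewrite !(subseq_uniq (map_subseq f _) fx).
rewrite linear0 big_seq big1 // => p px.
have [l [v [r e]]] := sorted_repeat (sorted_smap x) fx.
have : (map f p.1, map f p.2) \in cuts false i.+1 (map f x).
  by rewrite cuts_map; apply/mapP; exists p.
rewrite e => /cuts_repeat /=; rewrite negb_and.
have [p1 p2] := cuts_subseq px.
rewrite (smap_simp p1) (smap_simp p2).
by case: (uniq _) => /=; [move=> /negPf ->; rewrite linear0 | rewrite tens0l].
Qed.

Lemma cup_natural w :
  cup Y (tens_map id (smap_chain f) w)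
  = tens_map (smap_chain f) (smap_chain f) (cup X w).
Proof.
move: w; apply: linear_eq => [k u v|k u v|[[i t] x]]; try by rewrite !linearP.
rewrite -tensUU (tens_map_tens idfun) !cup_tens Delta_natural.
case: t => //=; move: (Delta X i _).
apply: linear_eq => [k u v|k u v|[y z]]; try by rewrite !linearP.
by rewrite swap_gen -!tensUU !tens_map_tens swap_tens.
Qed.

End Naturality.

Theorem theorem10 :
  exists D : cup_family,
    [/\ determined_by_Delta D,
        forall D' : cup_family, determined_by_Delta D' -> forall X, D' X =1 D X
      & cup_i_construction D].
Proof.
exists cup; split.
- split; first exact: cup_equivariant.
  by move=> X i c; rewrite /We cup_tens.
- move=> D' [eqD DE] X.
  apply: linear_eq => [k u v|k u v|[[i t] x]]; try by rewrite linearP.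
  rewrite -tensUU cup_tens; case: t; last exact: DE.
  rewrite /twist -DE -eqD; congr (D' X _).
  rewrite (tens_map_tens WT idfun) /We.
  by congr (_ ⊗ _); rewrite [RHS]linextU.
split.
- exact: cup_chain_map.
- exact: cup_equivariant.
- exact: cup_natural.
- exact: cup_neq0.
Qed.
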